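(* $\Xi(5)=8$, $\Xi(6)=9$, and $11\le\Xi(7)\le 12$.
   Context: All graphs are finite, simple and undirected. For a graph $G=(V,E)$ and $x\in V$, $N[x]=\{x\}\cup\{y: xy\in E\}$. A set $C\subseteq V$ is identifying if $N[x]\cap C\ne\emptyset$ for every $x\in V$ and $N[x]\cap C\neq N[y]\cap C$ for all distinct $x,y\in V$. For $n\ge k\ge1$, $\mathfrak{Gr}(n,k)$ is the set of graphs on $n$ vertices in which every $k$-element subset of vertices is identifying, and $\Xi(k)=\max\{n\ge k:\mathfrak{Gr}(n,k)\ne\emptyset\}$. *)

(* Defs.v *)
From mathcomp Require Import all_boot.

Set Implicit Arguments.
Unset Strict Implicit.
Unset Printing Implicit Defensive.

Record sgraph := SGraph {
  vertex :> finType;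
  edge : rel vertex;
  edge_sym : symmetric edge;
  edge_irrefl : irreflexive edge }.

Definition closed_nbhd (G : sgraph) (x : G) : {set G} :=
  x |: [set y | edge x y].

Definition identifying (G : sgraph) (C : {set G}) : Prop :=
  (forall x : G, closed_nbhd x :&: C != set0) /\
  (forall x y : G, x != y -> closed_nbhd x :&: C != closed_nbhd y :&: C).

Definition Gr (n k : nat) (G : sgraph) : Prop :=
  #|G| = n /\ forall C : {set G}, #|C| = k -> identifying C.

(* Xi is rendered as a relation: [is_Xi k m] says that the maximum defining
   Xi(k) exists and equals m. In particular it includes the boundedness of
   the set of admissible n, and it determines m uniquely. *)
Definition is_Xi (k m : nat) : Prop :=
  (k <= m /\ exists G : sgraph, Gr m k G) /\
  (forall n : nat, k <= n -> (exists G : sgraph, Gr n k G) -> n <= m).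

(* Main.v *)
Require Import Defs.
From mathcomp Require Import all_boot.
From mathcomp Require Import zify.
From Stdlib Require Import Classical.

(* Every k-subset of an n-vertex graph is identifying iff the closed
   neighbourhoods have at least d = n - k + 1 elements and differ pairwise in at
   least d places, so the rows of the (symmetric) matrix A + I form a code of
   distance d. Upper bounds are Plotkin double counting of the row distances,
   sharpened for odd d by the fact that rows whose weights have equal parity are
   at even distance. For (n, k) = (9, 5) and (13, 7) this is already
   contradictory. For (10, 6) the handshake lemma makes the number of even-weight
   rows even, which forces equality: four vertices have weight 6, six have weight
   5, all distances are determined, and the six vertices of weight 5 admit no
   consistent adjacency. Deleting vertices preserves the property, which reduces
   the upper bounds to these single orders. *)

Set Implicit Arguments.
Unset Strict Implicit.
Unset Printing Implicit Defensive.

(** * Symmetric differences and counting in finite sets *)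

Section FiniteSets.
Variable T : finType.
Implicit Types A B C : {set T}.

Definition symdiff A B : {set T} := [set z | (z \in A) (+) (z \in B)].

Lemma card_symdiff A B : #|symdiff A B| + #|A :&: B|.*2 = #|A| + #|B|.
Proof.
have -> : symdiff A B = (A :\: B) :|: (B :\: A).
  by apply/setP=> z; rewrite !inE; case: (z \in A); case: (z \in B).
rewrite cardsU (_ : (A :\: B) :&: (B :\: A) = set0) ?cards0; last first.
  by apply/setP=> z; rewrite !inE; case: (z \in A); case: (z \in B).
by have := cardsID B A; have := cardsID A B; rewrite (setIC B A); lia.
Qed.

Lemma odd_card_symdiff A B : odd #|symdiff A B| = odd #|A| (+) odd #|B|.
Proof. by rewrite -oddD -card_symdiff oddD odd_double addbF. Qed.

Lemma setI_neq_symdiff A B C : (A :&: C != B :&: C) = (symdiff A B :&: C != set0).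
Proof.
congr (~~ _); apply/eqP/eqP=> /setP eqAB; apply/setP=> z; move: (eqAB z);
  by rewrite !inE; case: (z \in A); case: (z \in B); case: (z \in C).
Qed.

Lemma exists_subset_card A k : k <= #|A| -> exists2 C : {set T}, C \subset A & #|C| = k.
Proof.
move=> le_kA; exists [set x in take k (enum A)].
  by apply/subsetP=> x; rewrite inE => /mem_take; rewrite mem_enum.
rewrite cardsE; have /card_uniqP -> := take_uniq k (enum_uniq A).
by rewrite size_takel -?cardE.
Qed.

(** [A] misses some [k]-subset exactly when its complement has room for one. *)
Lemma meets_all_card A k : k <= #|T| ->
  (forall C, #|C| = k -> A :&: C != set0) <-> #|T| < #|A| + k.
Proof.
move=> le_kT; split=> [meetA | lt_T C Ck].
  rewrite ltnNge; apply/negP=> le_T.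
  have [|C sCA Ck] := @exists_subset_card (~: A) k.
    by have := cardsC A; lia.
  by have := meetA C Ck; rewrite setI_eq0 disjoints_subset -setCS setCK sCA.
apply/negP=> /eqP AC0; have := cardsUI A C; rewrite AC0 cards0 Ck.
by have := cardsC (A :|: C); lia.
Qed.

(** The contribution of one column to the Plotkin count; the doubling comes from summing over
    ordered pairs. *)
Lemma sum_addb_mem A :
  \sum_(x : T) \sum_(y : T) ((x \in A) (+) (y \in A) : nat)
    = (#|A| * (#|T| - #|A|)).*2.
Proof.
have -> : #|T| - #|A| = #|~: A| by have := cardsC A; lia.
rewrite (bigID (mem A)) /=.
rewrite (eq_bigr (fun _ => #|~: A|)) => [|x ->]; last first.
  rewrite -sum1_card [RHS]big_mkcond.
  by apply: eq_bigr => y _ /=; rewrite inE; case: (y \in A).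
rewrite [X in _ + X](eq_bigr (fun _ => #|A|)) => [|x /negbTE ->]; last first.
  by rewrite -sum1_card [RHS]big_mkcond; apply: eq_bigr => y _ /=; case: (y \in A).
rewrite !sum_nat_const (_ : #|[pred x | x \notin A]| = #|~: A|).
  by rewrite [X in _ + X]mulnC addnn.
by apply: eq_card => x; rewrite !inE.
Qed.

Lemma sum_same_class (p : pred T) :
  \sum_(x : T) \sum_(y : T) (p x == p y : nat)
    = #|[set x | p x]| ^ 2 + #|[set x | ~~ p x]| ^ 2.
Proof.
rewrite (bigID p) /=.
rewrite (eq_bigr (fun _ => #|[set x | p x]|)) => [|x ->]; last first.
  by rewrite -sum1_card [RHS]big_mkcond; apply: eq_bigr => y _; rewrite inE; case: (p y).
rewrite [X in _ + X](eq_bigr (fun _ => #|[set x | ~~ p x]|)) => [|x /negbTE ->]; last first.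
  by rewrite -sum1_card [RHS]big_mkcond; apply: eq_bigr => y _; rewrite inE; case: (p y).
by rewrite !sum_nat_const !cardsE -!mulnn.
Qed.

End FiniteSets.

(** Serves the equality case of order 10, where tight sums force tight terms. *)
Lemma leq_sum_eq (I : finType) (F H : I -> nat) :
  (forall i, F i <= H i) -> \sum_i H i <= \sum_i F i -> F =1 H.
Proof.
move=> leFH leHF i; apply/eqP; rewrite eqn_leq leFH leqNgt; apply/negP=> ltFH.
move: leHF; rewrite leqNgt => /negP; apply.
rewrite (bigD1 i) //= [X in _ < X](bigD1 i) //= -addSn leq_add //.
by apply: leq_sum => j _.
Qed.

(** * Closed neighbourhoods as a code *)

Section Neighbourhoods.
Variable G : sgraph.
Implicit Types x y z : G.
Local Notation N := (@closed_nbhd G).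

Lemma closed_nbhd_refl x : x \in N x.
Proof. by rewrite !inE eqxx. Qed.

Lemma closed_nbhd_sym x y : (x \in N y) = (y \in N x).
Proof. by rewrite !inE eq_sym edge_sym. Qed.

(** [C] separates [x] from [y] iff it meets the symmetric difference of their neighbourhoods, so
    [meets_all_card] handles domination and separation alike. *)
Lemma Gr_card n k : k <= n -> Gr n k G <->
  [/\ #|G| = n, forall x, n < #|N x| + k
    & forall x y, x != y -> n < #|symdiff (N x) (N y)| + k].
Proof.
move=> le_kn; split=> [[Gn idG] | [Gn ltN ltD]].
  have le_kG : k <= #|G| by rewrite Gn.
  split=> // [x | x y neq_xy]; rewrite -Gn; apply/meets_all_card => // C /idG[dom sep].
    exact: dom.
  by rewrite -setI_neq_symdiff sep.
have le_kG : k <= #|G| by rewrite Gn.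
split=> // C Ck; split=> [x | x y neq_xy].
  by move: C Ck; apply/meets_all_card => //; rewrite Gn.
rewrite setI_neq_symdiff.
by move: C Ck; apply/meets_all_card => //; rewrite Gn ltD.
Qed.

(** Double counting of triples: by symmetry of adjacency, [z] distinguishes [x] from [y] iff exactly
    one of them lies in [N z]. *)
Lemma sum_card_symdiff :
  \sum_x \sum_y #|symdiff (N x) (N y)| = \sum_x (#|N x| * (#|G| - #|N x|)).*2.
Proof.
under [RHS]eq_bigr => z _ do rewrite -sum_addb_mem.
rewrite [RHS]exchange_big; apply: eq_bigr => x _ /=.
rewrite [RHS]exchange_big; apply: eq_bigr => y _ /=.
rewrite -sum1_card big_mkcond; apply: eq_bigr => z _ /=.
rewrite inE !(closed_nbhd_sym z).
by case: (_ (+) _).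
Qed.

Lemma sum_card_setI x : \sum_y #|N x :&: N y| = \sum_(z in N x) #|N z|.
Proof.
rewrite [RHS]big_mkcond.
under [RHS]eq_bigr => z _ do rewrite -sum1_card big_mkcond -if_neg.
transitivity (\sum_z \sum_y ((z \in N x) && (y \in N z) : nat)); last first.
  apply: eq_bigr => z _; case: (z \in N x) => /=; last by rewrite big1.
  by apply: eq_bigr => y _; case: (y \in N z).
rewrite exchange_big; apply: eq_bigr => y _ /=.
rewrite -sum1_card big_mkcond; apply: eq_bigr => z _ /=.
by rewrite inE (closed_nbhd_sym z y); case: (_ && _).
Qed.

Lemma odd_sum_card_closed_nbhd : odd (\sum_x #|N x|) = odd #|G|.
Proof.
(* Ordering the vertices orients each edge, so that the two sums in [cardN] become equal after
   exchange and cancel modulo 2. *)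
pose before x y := enum_rank x < enum_rank y.
have cardN x : #|N x| = 1 + \sum_y (edge x y && before x y : nat)
                          + \sum_y (edge y x && before y x : nat).
  rewrite cardsU1 inE edge_irrefl -addnA -big_split /= -sum1dep_card big_mkcond.
  congr (_ + _); apply: eq_bigr => y _; rewrite (edge_sym y) /before.
  case: ltngtP => //= [_|_|/val_inj/enum_rank_inj <-]; last by rewrite edge_irrefl.
    by rewrite andbT andbF; case: edge.
  by rewrite andbT andbF; case: edge.
under eq_bigr => x _ do rewrite cardN.
rewrite !big_split /= sum1_card [X in _ + X]exchange_big -addnA addnn /=.
by rewrite oddD odd_double addbF.
Qed.

Lemma parity_symdiff d x y : odd d -> d <= #|symdiff (N x) (N y)| ->
  d + (odd #|N x| == odd #|N y|) <= #|symdiff (N x) (N y)|.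
Proof.
move=> odd_d le_d; have [Exy|_] := eqP; last by rewrite addn0.
rewrite addn1 ltn_neqAle le_d andbT; apply/eqP=> Ed.
by move: odd_d; rewrite Ed odd_card_symdiff Exy addbb.
Qed.

(** The diagonal is left out of the double sum; each of its entries would be [d.+1], which the
    second summand restores. *)
Lemma sum_parity_weight d :
  \sum_x \sum_y (x != y) * (d + (odd #|N x| == odd #|N y|)) + d.+1 * #|G|
    = d * #|G| ^ 2 + #|[set x | odd #|N x|]| ^ 2 + #|[set x | ~~ odd #|N x|]| ^ 2.
Proof.
rewrite -addnA -sum_same_class.
have -> : d * #|G| ^ 2 = \sum_(x : G) \sum_(y : G) d.
  by rewrite !sum_nat_const -mulnn mulnC mulnA.
have -> : d.+1 * #|G| = \sum_(x : G) \sum_y (x == y) * d.+1.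
  rewrite mulnC -sum_nat_const; apply: eq_bigr => x _.
  rewrite (bigD1 x) //= eqxx mul1n big1 ?addn0 // => y.
  by rewrite eq_sym => /negbTE ->.
rewrite -!big_split; apply: eq_bigr => x _; rewrite -!big_split.
by apply: eq_bigr => y _ /=; have [->|] := eqVneq x y; rewrite ?eqxx; lia.
Qed.

End Neighbourhoods.

(** * Vertex deletion and the upper bounds *)

Lemma Gr_induced n m k (G : sgraph) : m <= n -> Gr n k G -> exists H, Gr m k H.
Proof.
move=> le_mn [Gn idG].
have [|S _ Sm] := @exists_subset_card G setT m; first by rewrite cardsT Gn.
pose e := [rel x y : {x : G | x \in S} | edge (val x) (val y)].
have e_sym : symmetric e by move=> x y; apply: edge_sym.
have e_irr : irreflexive e by move=> x; apply: edge_irrefl.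
pose H := SGraph e_sym e_irr.
exists H; split=> [|C Ck]; first by rewrite card_sig -Sm; apply: eq_card.
have [|dom sep] := idG (val @: C); first by rewrite card_imset //; apply: val_inj.
(* Since [C] lies inside the induced subgraph, neighbourhoods have the same trace on it in both
   graphs. *)
have trace (x : H) : closed_nbhd (val x) :&: (val @: C) = val @: (closed_nbhd x :&: C).
  apply/setP=> z; apply/setIP/imsetP=> [[xz /imsetP[y Cy Ez]] | [y xyC ->]].
    by exists y => //; move: xz; rewrite Ez !inE Cy andbT.
  by move: xyC; rewrite !inE => /andP[-> Cy]; split=> //; apply/imsetP; exists y.
split=> [x | x y neq_xy].
  by have := dom (val x); rewrite trace; apply: contra => /eqP ->; rewrite imset0.
have := sep (val x) (val y) neq_xy; rewrite !trace.
by apply: contra => /eqP ->.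
Qed.

Lemma Gr_odd_empty k (G : sgraph) : odd k -> 1 < k -> ~ Gr k.*2.-1 k G.
Proof.
move=> odd_k k_gt1 /Gr_card[|Gn ltN ltD]; first lia.
have := sum_parity_weight G k; have := sum_card_symdiff G.
(* Here n = 2k - 1 and all weights are at least k, where m(n - m) is decreasing, so m = k gives the
   maximum. *)
have : \sum_(x : G) (#|closed_nbhd x| * (#|G| - #|closed_nbhd x|)).*2
         <= #|G| * (k * k.-1).*2.
  rewrite -sum_nat_const; apply: leq_sum => x _.
  rewrite leq_double Gn; have := ltN x.
  by have := cardsC (closed_nbhd x); rewrite Gn; nia.
have : \sum_(x : G) \sum_y (x != y) * (k + (odd #|closed_nbhd x| == odd #|closed_nbhd y|))
         <= \sum_(x : G) \sum_(y : G) #|symdiff (closed_nbhd x) (closed_nbhd y)|.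
  apply: leq_sum => x _; apply: leq_sum => y _.
  have [//|neq_xy] := eqVneq x y; rewrite mul1n parity_symdiff //.
  by have := ltD x y neq_xy; lia.
have := cardsC [set x : G | odd #|closed_nbhd x|].
rewrite (_ : ~: _ = [set x : G | ~~ odd #|closed_nbhd x|]); last first.
  by apply/setP=> x; rewrite !inE.
rewrite Gn; move: #|_| #|_| => a b Eab.
move=> le_lower le_upper Esum Eparity.
(* By this identity the two estimates reduce to a^2 + b^2 <= a + b, impossible once a + b >= 3. *)
have Ek : k.*2.-1 * (k * k.-1).*2 + k.+1 * k.*2.-1 = k * k.*2.-1 ^ 2 + k.*2.-1.
  by rewrite -mulnn; case: (k) k_gt1 => // l _; rewrite doubleS /= -!muln2; nia.
have : a ^ 2 + b ^ 2 <= a + b by lia.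
by clear Eparity; case: a b Eab => [|[|a]] [|[|b]] Eab; rewrite -!mulnn; lia.
Qed.

Lemma Gr_10_6_empty (G : sgraph) : ~ Gr 10 6 G.
Proof.
move=> /Gr_card[//|Gn ltN ltD].
pose N := @closed_nbhd G.
pose A := [set x : G | ~~ odd #|N x|].
have cardNA : #|~: A| + #|A| = 10 by rewrite addnC cardsC Gn.
pose f (x y : G) := (x != y) * (5 + (odd #|N x| == odd #|N y|)).
have le_f x y : f x y <= #|symdiff (N x) (N y)|.
  rewrite /f; have [//|neq_xy] := eqVneq x y; rewrite mul1n parity_symdiff //.
  by have := ltD x y neq_xy; lia.
pose w (x : G) := (#|N x| * (10 - #|N x|)).*2.
(* Weights are at least 5; the best odd weight 5 gives 50, the best even weight 6 gives 48. *)
have le_w x : w x <= 48 + (x \in ~: A) * 2.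
  have := ltN x; rewrite -/(N x) /w !inE.
  by have := max_card (N x); rewrite Gn; case: (boolP (odd _));
    move: #|N x| => m; do 11?[case: m => [|m] //].
have sum_w : \sum_x (48 + (x \in ~: A) * 2) = 480 + #|~: A| * 2.
  rewrite big_split /= sum_nat_const Gn -big_distrl /= -sum1_card [in RHS]big_mkcond.
  by congr (_ + _ * _); apply: eq_bigr => x _; case: (_ \in _).
have le_sum_w : \sum_x w x <= 480 + #|~: A| * 2.
  by rewrite -sum_w; apply: leq_sum => x _.
have sum_f : \sum_x \sum_y f x y + 60 = 500 + #|~: A| ^ 2 + #|A| ^ 2.
  have := sum_parity_weight G 5; rewrite Gn /f => ->; congr (_ + _ ^ _ + _).
  by apply: eq_card => x; rewrite !inE negbK.
have sum_D : \sum_x \sum_y #|symdiff (N x) (N y)| = \sum_x w x.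
  by rewrite sum_card_symdiff; apply: eq_bigr => x _; rewrite Gn.
have le_sum_f : \sum_x \sum_y f x y <= \sum_x \sum_y #|symdiff (N x) (N y)|.
  by apply: leq_sum => x _; apply: leq_sum.
have evenA : ~~ odd #|A|.
  have := odd_sum_card_closed_nbhd G; rewrite Gn.
  have -> : odd (\sum_(x : G) #|closed_nbhd x|) = odd #|~: A|.
    rewrite -sum1_card [in RHS]big_mkcond /=.
    rewrite !(big_morph odd oddD (erefl : odd 0 = false)).
    by apply: eq_bigr => x _; rewrite !inE negbK; case: odd.
  by lia.
(* With a even and b odd weights, the bounds give a^2 + b^2 <= 40 + 2b, leaving only (4, 6) and (5,
   5); parity excludes the latter. *)
have cardA : #|A| = 4.
  move: evenA sum_f le_sum_f; rewrite sum_D.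
  by move: #|A| #|~: A| cardNA le_sum_w => a b; nia.
have cardCA : #|~: A| = 6 by lia.
rewrite cardA cardCA in sum_f le_sum_w.
(* Lower and upper bound are now both 492, so all termwise estimates are equalities. *)
have wE : w =1 fun x => 48 + (x \in ~: A) * 2.
  by apply: leq_sum_eq => //; rewrite sum_w cardCA; lia.
have fE x y : f x y = #|symdiff (N x) (N y)|.
  suff /(_ (x, y)) : (fun p => f p.1 p.2) =1 (fun p => #|symdiff (N p.1) (N p.2)|) by [].
  apply: leq_sum_eq => [[? ?] //|]; rewrite -(pair_bigA _ f).
  rewrite -(pair_bigA _ (fun x y => #|symdiff (N x) (N y)|)) /=.
  by lia.
(* Weight 4 would also give the value 48, but [ltN] rules it out. *)
have cardN x : #|N x| = 5 + (x \in A).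
  have := wE x; have := ltN x; rewrite -/(N x) /w !inE.
  by have := max_card (N x); rewrite Gn; case: (boolP (odd _));
    move: #|N x| => m; do 11?[case: m => [|m] //].
have cardI x y : x \notin A -> #|N x :&: N y| = 2 + (y \in A) + (x == y) * 3.
  move=> xA; have := card_symdiff (N x) (N y); rewrite -fE /f !cardN (negbTE xA).
  have [<-|_] := eqVneq x y; first by rewrite (negbTE xA); lia.
  by case: (y \in A) => /=; lia.
have cardNIA x : x \notin A -> #|N x :&: A| = 2.
  move=> xA; have := sum_card_setI x; rewrite -/N.
  under eq_bigr => y _ do rewrite (cardI x y xA).
  under [RHS]eq_bigr => z _ do rewrite cardN.
  (* The double count reads 20 + 4 + 3 = 25 + [#|N x :&: A|]. *)
  rewrite !big_split /= !sum_nat_const Gn cardN (negbTE xA).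
  rewrite -big_distrl /= (_ : \sum_y (x == y : nat) = 1); last first.
    by rewrite (bigD1 x) //= eqxx big1 // => y; rewrite eq_sym => /negbTE ->.
  rewrite (_ : \sum_y (y \in A : nat) = #|A|); last first.
    by rewrite -sum1_card [in RHS]big_mkcond; apply: eq_bigr => y _; case: (_ \in _).
  rewrite (_ : \sum_(z in N x) (z \in A : nat) = #|N x :&: A|); first lia.
  rewrite -sum1_card big_mkcond [in RHS]big_mkcond.
  by apply: eq_bigr => y _; rewrite in_setI; do 2!case: (_ \in _).
have [x xA] : exists x, x \in ~: A by apply/card_gt0P; rewrite cardCA.
rewrite inE in xA.
have cardAN : #|A :\: N x| = 2.
  by have := cardsID (N x) A; have := cardNIA x xA; rewrite setIC; lia.
(* N x meets A in only two of its four vertices, so the two neighbours of x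
   outside A are forced to have the same neighbours in A. *)
have nbr y : y \in N x :\: A :\ x -> N x :&: N y = [set x; y] /\ N y :&: A = A :\: N x.
  case/setD1P=> neq_yx /setDP[Nxy yA].
  have NI : N x :&: N y = [set x; y].
    apply/esym/eqP; rewrite eqEcard cards2 eq_sym neq_yx cardI //.
    rewrite (negbTE yA) (eq_sym x) (negbTE neq_yx) andbT subUset !sub1set !in_setI.
    by rewrite !closed_nbhd_refl Nxy closed_nbhd_sym Nxy.
  split=> //; apply/eqP; rewrite eqEcard cardAN cardNIA // andbT.
  apply/subsetP=> z /setIP[Nyz Az]; rewrite inE Az andbT; apply/negP=> Nxz.
  have : z \in N x :&: N y by rewrite inE Nxz.
  by rewrite NI !inE => /orP[]/eqP Ez; move: Az; rewrite Ez (negbTE xA, negbTE yA).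
have /eqP/cards2P[y [z [neq_yz Exyz]]] : #|N x :\: A :\ x| = 2.
  have := cardsD1 x (N x :\: A); rewrite in_setD xA closed_nbhd_refl.
  by have := cardsID A (N x); rewrite cardN (negbTE xA) cardNIA //; lia.
have [Dy Dz] : y \in N x :\: A :\ x /\ z \in N x :\: A :\ x.
  by rewrite Exyz !inE !eqxx orbT.
have [_ Ey] := nbr y Dy; have [_ Ez] := nbr z Dz.
case/setD1P: Dy => _ /setDP[Nxy yA]; case/setD1P: Dz => _ /setDP[Nxz zA].
(* Three common elements, whereas [cardI] allows only two. *)
have : #|x |: (A :\: N x)| <= #|N y :&: N z|.
  rewrite subset_leq_card // subUset sub1set in_setI.
  rewrite (closed_nbhd_sym x y) Nxy (closed_nbhd_sym x z) Nxz subsetI.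
  by rewrite -{1}Ey -Ez !subsetIl.
by rewrite cardsU1 cardAN in_setD (negbTE xA) andbF cardI // (negbTE zA) (negbTE neq_yz).
Qed.

(* The table entry of x lists the neighbours of x among the larger vertices. *)
Section Tables.
Variables (n : nat) (t : seq (seq nat)).

Definition table_adj (i j : nat) := (j \in nth [::] t i) || (i \in nth [::] t j).
Definition table_edge (x y : 'I_n) := (x != y) && table_adj x y.

Lemma table_edge_sym : symmetric table_edge.
Proof. by move=> x y; rewrite /table_edge /table_adj eq_sym orbC. Qed.

Lemma table_edge_irrefl : irreflexive table_edge.
Proof. by move=> x; rewrite /table_edge eqxx. Qed.

Definition table_graph := SGraph table_edge_sym table_edge_irrefl.

Definition table_nbhd (i : nat) : pred nat := fun j => (i == j) || table_adj i j.

(** Stated with [iota] and [count] on naturals so that [vm_compute] can evaluate the criterion of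
    [Gr_card]. *)
Definition table_check k := all (fun i =>
  (n < count (table_nbhd i) (iota 0 n) + k) && all (fun j =>
     (i == j) || (n < count (fun l => table_nbhd i l (+) table_nbhd j l) (iota 0 n) + k))
   (iota 0 n)) (iota 0 n).

Lemma card_ord_count (A : {set 'I_n}) (p : pred nat) :
  (forall x : 'I_n, (x \in A) = p x) -> #|A| = count p (iota 0 n).
Proof.
move=> Ap; rewrite -val_enum_ord count_map enumT cardE size_filter.
by apply: eq_count => x /=; rewrite -Ap.
Qed.

Lemma mem_table_nbhd (x y : 'I_n) :
  (y \in @closed_nbhd table_graph x) = table_nbhd x y.
Proof.
by rewrite !inE /= /table_edge /table_nbhd -val_eqE eq_sym -val_eqE /=; case: eqP.
Qed.

Lemma table_checkP k : k <= n -> table_check k -> Gr n k table_graph.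
Proof.
move=> le_kn /allP ok.
have ord_ok (x : 'I_n) := ok x; apply/Gr_card => //.
split=> [|x|x y neq_xy]; first exact: card_ord.
  have /andP[] := ord_ok x ltac:(by rewrite mem_iota ltn_ord).
  by rewrite -(card_ord_count (mem_table_nbhd x)).
have /andP[_ /allP/(_ (y : 'I_n))] := ord_ok x ltac:(by rewrite mem_iota ltn_ord).
rewrite mem_iota ltn_ord val_eqE (negbTE neq_xy) => /(_ isT).
rewrite -(card_ord_count (A := symdiff (@closed_nbhd table_graph x) (@closed_nbhd table_graph y))) //.
by move=> z; rewrite !inE -!mem_table_nbhd !inE.
Qed.

End Tables.

Definition table8 := [::
  [:: 1; 4; 5]; [:: 2; 7]; [:: 3; 5]; [:: 4; 7];
  [:: 6]; [:: 6]; [:: 7]; [::]].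

Lemma Gr_8_5 : Gr 8 5 (table_graph 8 table8).
Proof. by apply: table_checkP; vm_compute. Qed.

(* The 3 x 3 rook's graph, which is the Paley graph of order 9. *)
Definition table9 := [::
  [:: 1; 2; 3; 6]; [:: 2; 4; 7]; [:: 5; 8]; [:: 4; 5; 6]; [:: 5; 7];
  [:: 8]; [:: 7; 8]; [:: 8]; [::]].

Lemma Gr_9_6 : Gr 9 6 (table_graph 9 table9).
Proof. by apply: table_checkP; vm_compute. Qed.

Definition table11 := [::
  [:: 1; 3; 5; 8; 10]; [:: 2; 4; 9; 10]; [:: 3; 4; 6]; [:: 8; 9]; [:: 5; 7; 8]; [:: 6; 9];
  [:: 8; 9; 10]; [:: 8; 9; 10]; [::]; [::]; [::]].

Lemma Gr_11_7 : Gr 11 7 (table_graph 11 table11).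
Proof. by apply: table_checkP; vm_compute. Qed.

(** Any larger graph would induce one of order [m.+1]. *)
Lemma is_Xi_intro k m (G : sgraph) : k <= m -> Gr m k G ->
  (forall H, ~ Gr m.+1 k H) -> is_Xi k m.
Proof.
move=> le_km Gm no_Gr; split; first by split=> //; exists G.
move=> n _ [H Hn]; rewrite leqNgt; apply/negP=> lt_mn.
by have [H' /no_Gr] := Gr_induced lt_mn Hn.
Qed.

Theorem theorem18 :
  is_Xi 5 8 /\ is_Xi 6 9 /\ (exists m : nat, is_Xi 7 m /\ 11 <= m <= 12).
Proof.
split; first by apply: (is_Xi_intro _ Gr_8_5) => // H; apply: (@Gr_odd_empty 5).
split; first exact: (is_Xi_intro _ Gr_9_6 Gr_10_6_empty).
(* Order 12 is left undecided: excluded middle makes the maximum 12 or 11. *)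
have [[G G12]|no_Gr12] := classic (exists G, Gr 12 7 G).
  exists 12; split=> //.
  by apply: (is_Xi_intro _ G12) => // H; apply: (@Gr_odd_empty 7).
exists 11; split=> //; apply: (is_Xi_intro _ Gr_11_7) => // H H12.
by apply: no_Gr12; exists H.
Qed.
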